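(* Let $n\ge1$, let $V$ be a vector space over a field of characteristic zero, and let $\mu_{n+1,n}:V^{\otimes(n+1)}\to V^{\otimes n}$ be a generalized commutative associative product on $V$. Define $\mu_{2n,n}:V^{\otimes 2n}\to V^{\otimes n}$ as the composition of the maps $\mu_{n+1,n}\otimes \mathrm{id}_V^{\otimes k}$ for $k=n-1,\dots,1,0$, i.e. $$\mu_{2n,n}=\mu_{n+1,n}\circ(\mu_{n+1,n}\otimes \mathrm{id}_V)\circ\cdots\circ(\mu_{n+1,n}\otimes \mathrm{id}_V^{\otimes(n-1)}).$$ Then $\mu_{2n,n}$ defines a structure of a commutative associative (possibly non-unital) algebra on $\mathrm{Sym}^nV$.
   Context: A generalized commutative associative product on $V$ is a linear map $\mu_{n+1,n}:V^{\otimes(n+1)}\to V^{\otimes n}$ such that: (i) $\mu_{n+1,n}$ is invariant under the $S_{n+1}\times S_n$-action, i.e. it factorizes as $V^{\otimes(n+1)}\twoheadrightarrow(V^{\otimes(n+1)})_{S_{n+1}}\to(V^{\otimes n})^{S_n}\hookrightarrow V^{\otimes n}$; (ii) the map $\mu_{n+2,n}=\mu_{n+1,n}\circ(\mu_{n+1,n}\otimes \mathrm{id}_V):V^{\otimes(n+2)}\to V^{\otimes n}$ is $S_{n+2}\times S_n$-invariant, i.e. it factorizes through $(V^{\otimes(n+2)})_{S_{n+2}}$ and takes values in $(V^{\otimes n})^{S_n}$. $\mathrm{Sym}^nV$ is identified with both $(V^{\otimes n})_{S_n}$ and $(V^{\otimes n})^{S_n}$ via the natural isomorphism. The product on $\mathrm{Sym}^nV$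 is the map $\mathrm{Sym}^nV\otimes\mathrm{Sym}^nV\to\mathrm{Sym}^nV$ induced by $\mu_{2n,n}:V^{\otimes n}\otimes V^{\otimes n}\to V^{\otimes n}$. *)

(* Defs.v *)
From HB Require Import structures.
From mathcomp Require Import all_boot all_order all_fingroup all_algebra.
From mathcomp Require Import boolp.
From mathcomp Require Import freeg.

Set Implicit Arguments.
Unset Strict Implicit.
Unset Printing Implicit Defensive.

Import GRing.Theory.
Local Open Scope ring_scope.
Local Open Scope quotient_scope.

Section QuotientModule.
Variables (K : fieldType) (M : lmodType K).

Definition is_submodule (P : M -> Prop) : Prop :=
  P 0 /\ forall (a : K) (x y : M), P x -> P y -> P (a *: x + y).

Definition spanned (R : M -> Prop) : {pred M} := fun x =>
  `[< forall P : M -> Prop,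
        is_submodule P -> (forall r, R r -> P r) -> P x >].

Lemma spanned_submod (R : M -> Prop) : subsemimod_closed (spanned R).
Proof.
have sZD a x y : x \in spanned R -> y \in spanned R ->
    a *: x + y \in spanned R.
  move=> /asboolP hx /asboolP hy; apply/asboolP => P sP RP.
  by apply: sP.2; [apply: hx | apply: hy].
have s0 : 0 \in spanned R by apply/asboolP => P [].
split=> [|a x hx]; last by rewrite -[_ *: _]addr0 sZD.
by split=> // x y hx hy; rewrite -[x]scale1r sZD.
Qed.

HB.instance Definition _ (R : M -> Prop) :=
  GRing.isSubmodClosed.Build K M (spanned R) (spanned_submod R).

Lemma mem_spanned (R : M -> Prop) r : R r -> r \in spanned R.
Proof. by move=> Rr; apply/asboolP => P _; apply. Qed.

Definition quotmod (R : M -> Prop) := Quotient.quot (spanned R).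

HB.instance Definition _ (R : M -> Prop) := GRing.Zmodule.on (quotmod R).
HB.instance Definition _ (R : M -> Prop) := Choice.on (quotmod R).

Definition qproj (R : M -> Prop) (x : M) : quotmod R :=
  \pi_(Quotient.quot (spanned R)) x.

Definition qrepr (R : M -> Prop) (x : quotmod R) : M :=
  generic_quotient.repr (x : Quotient.quot (spanned R)).

Lemma qreprK (R : M -> Prop) : cancel (@qrepr R) (@qproj R).
Proof. by move=> x; apply: reprK. Qed.

Lemma qproj_eqP (R : M -> Prop) x y :
  reflect (qproj R x = qproj R y) (x - y \in spanned R).
Proof. by rewrite Quotient.idealrBE; apply: eqP. Qed.

Lemma qprojD (R : M -> Prop) x y : qproj R (x + y) = qproj R x + qproj R y.
Proof. by rewrite /qproj !piE. Qed.

Definition qscale (R : M -> Prop) (a : K) (x : quotmod R) : quotmod R :=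
  qproj R (a *: qrepr x).

Lemma qprojZ (R : M -> Prop) a x : qproj R (a *: x) = qscale a (qproj R x).
Proof.
apply/qproj_eqP; rewrite -scalerBr rpredZ //.
by apply/qproj_eqP; rewrite qreprK.
Qed.

Lemma qscaleA (R : M -> Prop) a b (x : quotmod R) :
  qscale a (qscale b x) = qscale (a * b) x.
Proof. by rewrite -[x]qreprK -!qprojZ scalerA. Qed.

Lemma qscale1 (R : M -> Prop) : left_id 1 (@qscale R).
Proof. by move=> x; rewrite -[x]qreprK -qprojZ scale1r. Qed.

Lemma qscaleDr (R : M -> Prop) : right_distributive (@qscale R) +%R.
Proof.
move=> a x y; rewrite -[x]qreprK -[y]qreprK -qprojD -!qprojZ.
by rewrite scalerDr qprojD.
Qed.

Lemma qscaleDl (R : M -> Prop) (x : quotmod R) :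
  {morph (@qscale R)^~ x : a b / a + b}.
Proof. by move=> a b; rewrite -[x]qreprK -!qprojZ scalerDl qprojD. Qed.

HB.instance Definition _ (R : M -> Prop) :=
  GRing.Zmodule_isLmodule.Build K (quotmod R)
    (@qscaleA R) (@qscale1 R) (@qscaleDr R) (@qscaleDl R).

Lemma qproj_is_linear (R : M -> Prop) : linear (qproj R).
Proof. by move=> a x y; rewrite qprojD qprojZ. Qed.

HB.instance Definition _ (R : M -> Prop) :=
  GRing.isLinear.Build K M (quotmod R) _ (qproj R) (@qproj_is_linear R).

Section Lift.
Variables (R : M -> Prop) (W : lmodType K) (f : {linear M -> W}).
Hypothesis f_rel : forall r, R r -> f r = 0.

Definition qlift (_ : forall r, R r -> f r = 0) (x : quotmod R) : W :=
  f (qrepr x).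

Lemma qliftE x : qlift f_rel (qproj R x) = f x.
Proof.
apply/subr0_eq; rewrite -linearB.
have /qproj_eqP/asboolP: qproj R (qrepr (qproj R x)) = qproj R x.
  by rewrite qreprK.
move/(_ (fun z => f z = 0)); apply=> //.
split=> [|a y z fy fz]; first exact: linear0.
by rewrite linearP fy fz scaler0 addr0.
Qed.

Lemma qlift_is_linear : linear (qlift f_rel).
Proof.
by move=> a x y; rewrite -[x]qreprK -[y]qreprK -linearP !qliftE linearP.
Qed.

HB.instance Definition _ :=
  GRing.isLinear.Build K (quotmod R) W _ (qlift f_rel) qlift_is_linear.
End Lift.

End QuotientModule.

Section FreeLift.
Variables (K : fieldType) (T : choiceType) (W : lmodType K) (f : T -> W).

Lemma fglift_is_linear : linear (fglift f : {freeg T / K} -> W).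
Proof.
have add : zmod_morphism (fglift f : {freeg T / K} -> W).
  by apply: lift_is_additive.
have f0 : fglift f (0 : {freeg T / K}) = 0 by rewrite -(subrr 0) add subrr.
have addD D E : fglift f (D + E) = fglift f D + fglift f E.
  by rewrite -[E in LHS]opprK -[- E]sub0r !add f0 sub0r opprK.
have sumE (I : Type) (s : seq I) (F : I -> {freeg T / K}) :
    fglift f (\sum_(i <- s) F i) = \sum_(i <- s) fglift f (F i).
  by apply: (big_morph (fglift f) addD f0).
move=> a D E; rewrite addD; congr (_ + _).
rewrite -[in RHS](freeg_sumE D) {1}/GRing.scale /= /fgscale !sumE scaler_sumr.
by apply: eq_bigr => x _; rewrite !liftU scalerA.
Qed.

HB.instance Definition _ :=
  GRing.isLinear.Build K {freeg T / K} W _ (fglift f : {freeg T / K} -> W) fglift_is_linear.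
End FreeLift.

Lemma freegU_scale (K : fieldType) (T : choiceType) (a : K) (x : T) :
  << a *g x >> = a *: << x >> :> {freeg T / K}.
Proof. by apply/eqP/freeg_eqP => y; rewrite coeffZ !coeffU mul1r. Qed.

Section TensorPower.
Variables (K : fieldType) (V : lmodType K).

Definition upd n (v : {ffun 'I_n -> V}) (i : 'I_n) (x : V) : {ffun 'I_n -> V} :=
  [ffun j => if j == i then x else v j].

Definition multilinear n (W : lmodType K) (f : {ffun 'I_n -> V} -> W) : Prop :=
  forall v i (a : K) (x y : V),
    f (upd v i (a *: x + y)) = a *: f (upd v i x) + f (upd v i y).

Definition tens_relator n (d : {freeg {ffun 'I_n -> V} / K}) : Prop :=
  exists v i (a : K) (x y : V),
    d = << upd v i (a *: x + y) >>
        - (a *: << upd v i x >> + << upd v i y >>).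

(* V^(x)n, as the free vector space on V^n modulo multilinearity; [tliftE] and
   [tens_ext] are its universal property. *)
Definition tens n := quotmod (@tens_relator n).
HB.instance Definition _ n := GRing.Lmodule.on (tens n).

(* pure v is the decomposable tensor v_0 (x) ... (x) v_(n-1). *)
Definition pure n (v : {ffun 'I_n -> V}) : tens n :=
  qproj (@tens_relator n) << v >>.

Lemma pure_multilinear n : multilinear (@pure n).
Proof.
move=> v i a x y; rewrite /pure -linearP; apply/qproj_eqP/mem_spanned.
by exists v, i, a, x, y.
Qed.

Section Lift.
Variables (n : nat) (W : lmodType K) (f : {ffun 'I_n -> V} -> W).
Hypothesis f_ml : multilinear f.

Lemma multilinear_relator d : tens_relator d -> fglift f d = 0.
Proof.
by move=> [v [i [a [x [y ->]]]]]; rewrite linearB linearP /= !liftU !scale1r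
  f_ml subrr.
Qed.

Definition tlift : tens n -> W := qlift multilinear_relator.
HB.instance Definition _ := GRing.Linear.copy tlift (qlift multilinear_relator).

Lemma tliftE v : tlift (pure v) = f v.
Proof. by rewrite /tlift /pure qliftE /= liftU scale1r. Qed.
End Lift.

Lemma tens_ext n (W : lmodType K) (f g : {linear tens n -> W}) :
  (forall v, f (pure v) = g (pure v)) -> f =1 g.
Proof.
move=> fg x; rewrite -[x]qreprK -(freeg_sumE (qrepr x)) !linear_sum.
by apply: eq_bigr => v _; rewrite freegU_scale !linearZ /= fg.
Qed.

Lemma multilinear_reindex n m (s : 'I_n -> 'I_m) (bs : bijective s) :
  multilinear (fun v : {ffun 'I_m -> V} => pure [ffun i => v (s i)]).
Proof.
case: bs => t stK tsK v i a x y /=.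
have updE z : [ffun j => upd v i z (s j)] = upd [ffun j => v (s j)] (t i) z.
  by apply/ffunP => j; rewrite !ffunE (can2_eq stK tsK).
by rewrite !updE pure_multilinear.
Qed.

Lemma tens_ind n (P : tens n -> Prop) :
  is_submodule P -> (forall v, P (pure v)) -> forall x, P x.
Proof.
move=> [P0 PD] Pp x; rewrite -[x]qreprK -(freeg_sumE (qrepr x)) linear_sum.
elim/big_ind: _ => // [y z Py Pz|v _]; first by rewrite -[y]scale1r; apply: PD.
by rewrite freegU_scale linearZ -[X in P X]addr0; exact: (PD _ _ _ (Pp v) P0).
Qed.

Lemma cast_ord_bij n m (e : n = m) : bijective (cast_ord e).
Proof. exact: Bijective (cast_ordK e) (cast_ordKV e). Qed.

Definition tcast n m (e : n = m) : tens n -> tens m :=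
  tlift (multilinear_reindex (cast_ord_bij (esym e))).
HB.instance Definition _ n m (e : n = m) :=
  GRing.Linear.copy (tcast e) (tlift (multilinear_reindex (cast_ord_bij (esym e)))).

(* Place permutation v |-> v o s: a right action of 'S_n, with the same orbits,
   invariants and coinvariants as the left action by s^-1. *)
Lemma perm_inj_bij n (s : 'S_n) : bijective s.
Proof. exact: injF_bij perm_inj. Qed.

Definition tens_perm n (s : 'S_n) : tens n -> tens n :=
  tlift (multilinear_reindex (perm_inj_bij s)).
HB.instance Definition _ n (s : 'S_n) :=
  GRing.Linear.copy (tens_perm s) (tlift (multilinear_reindex (perm_inj_bij s))).

Definition ucat n m (u : {ffun 'I_n -> V}) (v : {ffun 'I_m -> V}) :
    {ffun 'I_(n + m) -> V} :=
  [ffun i => match split i with inl j => u j | inr k => v k end].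
Definition utake n m (w : {ffun 'I_(n + m) -> V}) : {ffun 'I_n -> V} :=
  [ffun i => w (lshift m i)].
Definition udrop n m (w : {ffun 'I_(n + m) -> V}) : {ffun 'I_m -> V} :=
  [ffun i => w (rshift n i)].

Lemma ucat_updl n m (u : {ffun 'I_n -> V}) (v : {ffun 'I_m -> V}) i x :
  ucat (upd u i x) v = upd (ucat u v) (lshift m i) x.
Proof.
apply/ffunP => j; rewrite !ffunE -{2}[j]splitK.
by case: (split j) => k /=; rewrite ?ffunE ?eq_lshift ?eq_rlshift.
Qed.

Lemma ucat_updr n m (u : {ffun 'I_n -> V}) (v : {ffun 'I_m -> V}) i x :
  ucat u (upd v i x) = upd (ucat u v) (rshift n i) x.
Proof.
apply/ffunP => j; rewrite !ffunE -{2}[j]splitK.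
by case: (split j) => k /=; rewrite ?ffunE ?eq_rshift ?eq_lrshift.
Qed.

Lemma utake_ucat n m (u : {ffun 'I_n -> V}) (v : {ffun 'I_m -> V}) :
  utake (ucat u v) = u.
Proof. by apply/ffunP => i; rewrite !ffunE (unsplitK (inl i)). Qed.

Lemma udrop_ucat n m (u : {ffun 'I_n -> V}) (v : {ffun 'I_m -> V}) :
  udrop (ucat u v) = v.
Proof. by apply/ffunP => i; rewrite !ffunE (unsplitK (inr i)). Qed.

Lemma ucat_take_drop n m (w : {ffun 'I_(n + m) -> V}) :
  ucat (utake w) (udrop w) = w.
Proof.
apply/ffunP => i; rewrite !ffunE -{2}[i]splitK.
by case: (split i) => k; rewrite ffunE.
Qed.

Lemma multilinear_ucatr n m (u : {ffun 'I_n -> V}) :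
  multilinear (fun v : {ffun 'I_m -> V} => pure (ucat u v)).
Proof. by move=> v i a x y; rewrite !ucat_updr pure_multilinear. Qed.

Lemma multilinear_ucatl n m (y : tens m) :
  multilinear (fun u : {ffun 'I_n -> V} => tlift (multilinear_ucatr u) y).
Proof.
move=> u i a x z.
pose F := tlift (multilinear_ucatr (m := m) (upd u i (a *: x + z))).
pose G := (a \*: tlift (multilinear_ucatr (m := m) (upd u i x))) \+
          tlift (multilinear_ucatr (m := m) (upd u i z)).
apply: (tens_ext (f := F) (g := G)) => v; rewrite /G /F /= !tliftE.
by rewrite !ucat_updl pure_multilinear.
Qed.

(* The identification of T^n (x) T^m with T^(n+m), as a bilinear map. *)
Definition tmul n m (x : tens n) (y : tens m) : tens (n + m) :=
  tlift (multilinear_ucatl y) x.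

Lemma tmul_pure n m (u : {ffun 'I_n -> V}) (v : {ffun 'I_m -> V}) :
  tmul (pure u) (pure v) = pure (ucat u v).
Proof. by rewrite /tmul !tliftE. Qed.

Lemma tmul_is_bilinear n m :
  bilinear_for ( *:%R ) ( *:%R ) (@tmul n m).
Proof.
split=> [y a x x'|x a y y']; first by rewrite /tmul linearP.
pose F := tlift (@multilinear_ucatl n m (a *: y + y')).
pose G := (a \*: tlift (@multilinear_ucatl n m y)) \+
          tlift (@multilinear_ucatl n m y').
apply: (tens_ext (f := F) (g := G)) => v; rewrite /G /F /= !tliftE.
by rewrite linearP.
Qed.

HB.instance Definition _ n m :=
  bilinear_isBilinear.Build K (tens n) (tens m) (tens (n + m)) _ _
    (@tmul n m) (@tmul_is_bilinear n m).

Lemma multilinear_tensid n m k (f : {linear tens n -> tens m}) :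
  multilinear (fun w : {ffun 'I_(n + k) -> V} =>
                 tmul (f (pure (utake w))) (pure (udrop w))).
Proof.
move=> w i a x y; rewrite -[w]ucat_take_drop -[i]splitK.
case: (split i) => j /=.
  by rewrite -!ucat_updl !utake_ucat !udrop_ucat pure_multilinear linearP
    linearPl.
by rewrite -!ucat_updr !utake_ucat !udrop_ucat pure_multilinear linearPr.
Qed.

(* f (x) id_V^(x)k *)
Definition tensid n m k (f : {linear tens n -> tens m}) :
    tens (n + k) -> tens (m + k) :=
  tlift (multilinear_tensid (k := k) f).
Arguments tensid [n m] k f x.
HB.instance Definition _ n m k (f : {linear tens n -> tens m}) :=
  GRing.Linear.copy (tensid k f) (tlift (multilinear_tensid (k := k) f)).

Lemma tensid_tmul n m k (f : {linear tens n -> tens m})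
  (x : tens n) (y : tens k) : tensid k f (tmul x y) = tmul (f x) y.
Proof.
move: x; apply: tens_ind => [|u].
  by split=> [|a x x' hx hx']; rewrite ?linear0l ?linear0 ?linear0l //
    !linearPl !linearP /= hx hx' linearPl.
move: y; apply: tens_ind => [|v].
  by split=> [|a y y' hy hy']; rewrite ?linear0r ?linear0 //
    !linearPr linearP /= hy hy'.
by rewrite tmul_pure /tensid tliftE utake_ucat udrop_ucat.
Qed.

End TensorPower.

Arguments tensid [K V n m] k f x.

Section SymmetricPower.
Variables (K : fieldType) (V : lmodType K).

Definition coinv_relator n (d : tens V n) : Prop :=
  exists (s : 'S_n) (x : tens V n), d = tens_perm s x - x.

(* (V^(x)n)_(S_n) *)
Definition coinv n := quotmod (@coinv_relator n).
HB.instance Definition _ n := GRing.Lmodule.on (coinv n).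

Definition coinv_proj n : tens V n -> coinv n := qproj (@coinv_relator n).
HB.instance Definition _ n :=
  GRing.Linear.copy (@coinv_proj n) (qproj (@coinv_relator n)).

Definition invariant n : {pred tens V n} :=
  fun x => [forall s : 'S_n, tens_perm s x == x].

Lemma invariantP n (x : tens V n) :
  reflect (forall s : 'S_n, tens_perm s x = x) (x \in @invariant n).
Proof. exact: 'forall_eqP. Qed.

Lemma invariant_submod n : subsemimod_closed (@invariant n).
Proof.
split=> [|a x /invariantP hx]; last by apply/invariantP => s; rewrite linearZ /= hx.
split=> [|x y /invariantP hx /invariantP hy]; apply/invariantP => s.
  exact: linear0.
by rewrite linearD /= hx hy.
Qed.

HB.instance Definition _ n :=
  GRing.isSubmodClosed.Build K (tens V n) (@invariant n) (@invariant_submod n).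

(* (V^(x)n)^(S_n) *)
Record inv n := Inv { inv_val :> tens V n; _ : inv_val \in @invariant n }.
HB.instance Definition _ n := [isSub for @inv_val n].
HB.instance Definition _ n := [Choice of inv n by <:].
HB.instance Definition _ n := [SubChoice_isSubLmodule of inv n by <:].

(* The natural isomorphism; see [inv_coinv_bij]. *)
Definition inv_coinv n (x : inv n) : coinv n := coinv_proj (inv_val x).

Lemma inv_coinv_is_linear n : linear (@inv_coinv n).
Proof. by move=> a x y; rewrite /inv_coinv -linearP. Qed.
HB.instance Definition _ n :=
  GRing.isLinear.Build K (inv n) (coinv n) _ (@inv_coinv n)
    (@inv_coinv_is_linear n).


Lemma tens_permM n (s t : 'S_n) (x : tens V n) :
  tens_perm s (tens_perm t x) = tens_perm (s * t)%g x.
Proof.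
move: x; apply: tens_ind => [|v].
  by split=> [|a x y hx hy]; rewrite ?linear0 // !linearP /= hx hy.
rewrite /tens_perm !tliftE; congr pure.
by apply/ffunP => i; rewrite !ffunE permM.
Qed.

Lemma coinv_projP n (x : tens V n) (s : 'S_n) :
  coinv_proj (tens_perm s x) = coinv_proj x.
Proof. by apply/qproj_eqP/mem_spanned; exists s, x. Qed.

Definition tens_norm n (x : tens V n) : tens V n := \sum_(s : 'S_n) tens_perm s x.

Lemma tens_norm_is_linear n : linear (@tens_norm n).
Proof.
move=> a x y; rewrite /tens_norm scaler_sumr -big_split /=.
by apply: eq_bigr => s _; rewrite linearP.
Qed.
HB.instance Definition _ n :=
  GRing.isLinear.Build K (tens V n) (tens V n) _ (@tens_norm n)
    (@tens_norm_is_linear n).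

Lemma inv_coinv_bij n : [pchar K] =i pred0 -> bijective (@inv_coinv n).
Proof.
move=> charK; have nz : (#|{: 'S_n}|)%:R != 0 :> K.
  by rewrite ((pcharf0P K).1 charK) -lt0n; apply/card_gt0P; exists 1%g.
pose c : K := (#|{: 'S_n}|)%:R^-1.
have Nrel (r : tens V n) : coinv_relator r -> c *: tens_norm r = 0.
  move=> [s [x ->]]; rewrite linearB /= [X in X - _](_ : _ = tens_norm x).
    by rewrite subrr scaler0.
  rewrite /tens_norm [RHS](reindex_inj (mulIg s)) /=.
  by apply: eq_bigr => t _; rewrite tens_permM.
have Ninv (x : tens V n) : c *: tens_norm x \in @invariant n.
  apply/invariantP => s; rewrite linearZ /=; congr (_ *: _).
  rewrite /tens_norm linear_sum [RHS](reindex_inj (mulgI s)) /=.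
  by apply: eq_bigr => t _; rewrite tens_permM.
pose N := c \*: @tens_norm n.
exists (fun a : coinv n => Inv (Ninv (qrepr a))) => a.
  have NE x : c *: tens_norm x = qlift (f := N) Nrel (coinv_proj x).
    by rewrite /coinv_proj qliftE.
  apply: val_inj => /=; rewrite NE /coinv_proj qreprK -NE /tens_norm.
  under eq_bigr => s _ do rewrite (invariantP _ (valP a)).
  by rewrite sumr_const -scaler_nat scalerA mulVf // scale1r.
rewrite /inv_coinv /= linearZ /= /tens_norm linear_sum /=.
under eq_bigr => s _ do rewrite coinv_projP /coinv_proj qreprK.
by rewrite sumr_const -scaler_nat scalerA mulVf // scale1r.
Qed.

(* f factors as V^(x)m ->> (V^(x)m)_(S_m) -> (V^(x)n)^(S_n) >-> V^(x)n. *)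
Definition sym_factors m n (f : tens V m -> tens V n) : Prop :=
  exists g : {linear coinv m -> inv n}, forall x, f x = inv_val (g (coinv_proj x)).

Lemma sym_factorsP m n (f : {linear tens V m -> tens V n}) :
  sym_factors f <->
  (forall (s : 'S_m) x, f (tens_perm s x) = f x) /\
  (forall (s : 'S_n) x, tens_perm s (f x) = f x).
Proof.
split=> [[g fE]|[fm fn]].
  split=> s x; first by rewrite !fE coinv_projP.
  by rewrite fE; apply: (invariantP _ (valP (g (coinv_proj x)))).
have finv x : f x \in @invariant n by apply/invariantP => s; apply: fn.
pose h x := Inv (finv x).
have h_lin : linear h by move=> a x y; apply: val_inj; rewrite /= linearP.
pose hl := GRing.isLinear.Build K (tens V m) (inv n) _ h h_lin.
pose H : {linear tens V m -> inv n} := HB.pack h hl.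
have Hrel r : coinv_relator r -> H r = 0.
  move=> [s [x ->]]; rewrite linearB /=; apply/eqP; rewrite subr_eq0; apply/eqP.
  by apply: val_inj; rewrite /= fm.
exists (qlift (f := H) Hrel) => x.
exact: esym (congr1 (@inv_val n) (qliftE Hrel x)).
Qed.

Definition mu_plus2 n (mu : {linear tens V n.+1 -> tens V n}) :
    tens V (n.+1 + 1) -> tens V n :=
  fun x => mu (tcast (addn1 n) (tensid 1 mu x)).

Definition gen_comm_assoc_product n (mu : {linear tens V n.+1 -> tens V n}) :
    Prop :=
  sym_factors mu /\ sym_factors (mu_plus2 mu).

(* mu_chain mu k = mu o (mu (x) id) o ... o (mu (x) id^(x)(k-1)), a map
   V^(x)(n+k) -> V^(x)n; n.+1 + k and (n + k).+1 are convertible. *)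
Fixpoint mu_chain n (mu : {linear tens V n.+1 -> tens V n}) (k : nat) :
    tens V (n + k) -> tens V n :=
  match k with
  | 0 => tcast (addn0 n)
  | k'.+1 => fun x =>
      mu_chain mu (tensid k' mu (tcast (addnS n k' : (n + k'.+1 = n.+1 + k')%N) x))
  end.

Definition SymPow n := coinv n.
HB.instance Definition _ n := GRing.Lmodule.on (SymPow n).

(* op is the product on Sym^n V obtained by factoring M through the
   coinvariants in each argument and the invariants in the target, and then
   identifying invariants with coinvariants. *)
Definition induced_product n (M : tens V (n + n) -> tens V n)
    (op : SymPow n -> SymPow n -> SymPow n) : Prop :=
  exists g : {bilinear coinv n -> coinv n -> inv n},
    (forall x y, inv_val (g (coinv_proj x) (coinv_proj y)) = M (tmul x y)) /\
    (forall a b, op a b = inv_coinv (g a b)).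

End SymmetricPower.

Arguments mu_chain [K V n] mu k x.
Arguments SymPow [K] V n.

(* Main.v *)
(* Symmetry of [mu_(n+k,n)] for k >= 1 goes by induction on k: writing it as
   [mu_(n+k-1,n) o (mu (x) id)], it is symmetric in the first n+2 arguments
   because [mu o (mu (x) id)] is, and in the last k-1 ones by induction; these
   two groups of permutations generate 'S_(n+k).
   Symmetry of [mu_(2n,n)] gives commutativity.  Moreover
   [(a b) c = mu_(3n,n) (a (x) b (x) c)], and this is invariant under cyclic
   rotation, so [(a b) c = (b c) a = a (b c)]. *)
From HB Require Import structures.
From mathcomp Require Import all_boot all_fingroup all_algebra.
Require Import Defs.

Set Implicit Arguments.
Unset Strict Implicit.
Unset Printing Implicit Defensive.

Import GRing.Theory.
Local Open Scope ring_scope.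

(** * Casts between tensor powers and concatenation of tensors *)

Section TensorCasts.
Variables (K : fieldType) (V : lmodType K).
Implicit Types (n m p : nat).

Lemma tens_perm_pure n (s : 'S_n) (v : {ffun 'I_n -> V}) :
  tens_perm s (pure v) = pure [ffun i => v (s i)].
Proof. by rewrite /tens_perm tliftE. Qed.

Lemma tcast_pure n m (e : n = m) (v : {ffun 'I_n -> V}) :
  tcast e (pure v) = pure [ffun i => v (cast_ord (esym e) i)].
Proof. by rewrite /tcast tliftE. Qed.

Lemma tcast_id n (e : n = n) (x : tens V n) : tcast e x = x.
Proof.
apply: (tens_ext (f := tcast e) (g := idfun)) => v /=; rewrite tcast_pure.
by congr pure; apply/ffunP => i; rewrite ffunE cast_ord_id.
Qed.

Lemma tcast_comp n m p (e : n = m) (e' : m = p) (x : tens V n) :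
  tcast e' (tcast e x) = tcast (etrans e e') x.
Proof. by case: p / e'; case: m / e; rewrite !tcast_id. Qed.

Lemma tcast_irr n m (e e' : n = m) (x : tens V n) : tcast e x = tcast e' x.
Proof. by rewrite (eq_irrelevance e e'). Qed.

Lemma tmul_castl n m p (e : n = m) (e' : (n + p = m + p)%N)
    (x : tens V n) (y : tens V p) :
  tmul (tcast e x) y = tcast e' (tmul x y).
Proof. by case: m / e e' => e'; rewrite !tcast_id. Qed.

(** A form of [tens_ext] for bare functions: composites such as [fun x => f (tmul x y)] then need
    only a proof of linearity, not a packed structure. *)
Lemma linear_pure_ext n (W : lmodType K) (f g : tens V n -> W) :
  linear f -> linear g -> (forall v, f (pure v) = g (pure v)) -> f =1 g.
Proof.
move=> fL gL fg.
pose F : {linear _ -> _} := HB.pack f (GRing.isLinear.Build _ _ _ _ f fL).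
pose G : {linear _ -> _} := HB.pack g (GRing.isLinear.Build _ _ _ _ g gL).
exact: (tens_ext (f := F) (g := G)).
Qed.

Lemma linear_tmul_ext n m (W : lmodType K) (f g : tens V (n + m) -> W) :
  linear f -> linear g -> (forall x y, f (tmul x y) = g (tmul x y)) -> f =1 g.
Proof.
move=> fL gL fg; apply: linear_pure_ext => // v.
by rewrite -[v]ucat_take_drop -tmul_pure fg.
Qed.

(** By trilinearity it suffices to compare concatenated families on each of the three blocks. The
    cast is there because the two types are not convertible. *)
Lemma tmulA n m p (e : (n + (m + p) = n + m + p)%N)
    (x : tens V n) (y : tens V m) (z : tens V p) :
  tcast e (tmul x (tmul y z)) = tmul (tmul x y) z.
Proof.
move: x; apply: linear_pure_ext => [a ? ?|a ? ?|u].
- by rewrite linearPl linearP.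
- by rewrite !linearPl.
move: y; apply: linear_pure_ext => [a ? ?|a ? ?|v].
- by rewrite linearPl linearPr linearP.
- by rewrite linearPr linearPl.
move: z; apply: linear_pure_ext => [a ? ?|a ? ?|w].
- by rewrite !linearPr linearP.
- by rewrite linearPr.
rewrite !tmul_pure tcast_pure; congr pure; apply/ffunP => i; rewrite !ffunE.
case: (split_ordP i) => [j ->|k ->]; rewrite ?ffunE.
  case: (split_ordP j) => [j' ->|j' ->].
    rewrite (_ : cast_ord _ _ = lshift _ j'); last exact: val_inj.
    by rewrite (unsplitK (inl _)).
  rewrite (_ : cast_ord _ _ = rshift _ (lshift _ j')); last exact: val_inj.
  by rewrite (unsplitK (inr _)) ffunE (unsplitK (inl _)).
rewrite (_ : cast_ord _ _ = rshift _ (rshift _ k)); last first.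
  by apply: val_inj; rewrite /= addnA.
by rewrite (unsplitK (inr _)) ffunE (unsplitK (inr _)).
Qed.

Lemma tmul_pure0 n (e : (n + 0 = n)%N) (x : tens V n) (v : {ffun 'I_0 -> V}) :
  tcast e (tmul x (pure v)) = x.
Proof.
move: x; apply: linear_pure_ext => [a ? ?|//|u].
  by rewrite linearPl linearP.
rewrite tmul_pure tcast_pure; congr pure; apply/ffunP => i; rewrite !ffunE.
by rewrite (_ : cast_ord _ _ = lshift 0 i) ?(unsplitK (inl _)) //; apply: val_inj.
Qed.

Lemma tens_perm1 n (x : tens V n) : tens_perm 1%g x = x.
Proof.
apply: (tens_ext (f := tens_perm 1%g) (g := idfun)) => v /=.
rewrite tens_perm_pure; congr pure.
by apply/ffunP => i; rewrite ffunE perm1.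
Qed.

(** Transpositions suffice, since they generate the symmetric group; this avoids extending a general
    permutation of one block to all factors. *)
Lemma tmul_perml n m (i j : 'I_n) (x : tens V n) (y : tens V m) :
  tmul (tens_perm (tperm i j) x) y =
  tens_perm (tperm (lshift m i) (lshift m j)) (tmul x y).
Proof.
move: x; apply: linear_pure_ext => [a ? ?|a ? ?|u].
- by rewrite !(linearPl, linearP).
- by rewrite !(linearPl, linearP).
move: y; apply: linear_pure_ext => [a ? ?|a ? ?|v].
- by rewrite !(linearPr, linearP).
- by rewrite !(linearPr, linearP).
rewrite tens_perm_pure !tmul_pure tens_perm_pure; congr pure.
apply/ffunP => k; rewrite !ffunE; case: (split_ordP k) => k' ->.
  by rewrite -(inj_tperm _ _ _ (@lshift_inj n m)) (unsplitK (inl _)) ffunE.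
by rewrite tpermD ?eq_lrshift // (unsplitK (inr _)).
Qed.

Lemma tmul_permr n m (i j : 'I_m) (x : tens V n) (y : tens V m) :
  tmul x (tens_perm (tperm i j) y) =
  tens_perm (tperm (rshift n i) (rshift n j)) (tmul x y).
Proof.
move: x; apply: linear_pure_ext => [a ? ?|a ? ?|u].
- by rewrite !(linearPl, linearP).
- by rewrite !(linearPl, linearP).
move: y; apply: linear_pure_ext => [a ? ?|a ? ?|v].
- by rewrite !(linearPr, linearP).
- by rewrite !(linearPr, linearP).
rewrite tens_perm_pure !tmul_pure tens_perm_pure; congr pure.
apply/ffunP => k; rewrite !ffunE; case: (split_ordP k) => k' ->.
  by rewrite tpermD ?eq_rlshift // (unsplitK (inl _)).
by rewrite -(inj_tperm _ _ _ (@rshift_inj n m)) (unsplitK (inr _)) ffunE.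
Qed.

End TensorCasts.

(** * Maps invariant under permutation of the tensor factors *)

Section SymmetricMaps.
Variables (K : fieldType) (V W : lmodType K).

Definition perm_invariant n (f : tens V n -> W) : Prop :=
  forall (s : 'S_n) x, f (tens_perm s x) = f x.

Definition swap_invariant n (f : tens V n -> W) (i j : 'I_n) : Prop :=
  forall x, f (tens_perm (tperm i j) x) = f x.

Lemma perm_invariant_tperm n (f : tens V n -> W) :
  (forall i j, swap_invariant f i j) -> perm_invariant f.
Proof.
move=> ft s; have [ts -> _] := prod_tpermP s.
elim: ts => [|t ts IHts] x; first by rewrite big_nil tens_perm1.
by rewrite big_cons -tens_permM ft IHts.
Qed.

Lemma perm_invariant_tmull n m (f : tens V (n + m) -> W) (y : tens V m) :
  perm_invariant f -> perm_invariant (fun x => f (tmul x y)).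
Proof.
move=> fs s x; have [ts -> _] := prod_tpermP s; elim: ts x => [|t ts IHts] x.
  by rewrite big_nil tens_perm1.
by rewrite big_cons -tens_permM tmul_perml fs IHts.
Qed.

Lemma perm_invariant_tmulr n m (f : tens V (n + m) -> W) (x : tens V n) :
  perm_invariant f -> perm_invariant (fun y => f (tmul x y)).
Proof.
move=> fs s y; have [ts -> _] := prod_tpermP s; elim: ts y => [|t ts IHts] y.
  by rewrite big_nil tens_perm1.
by rewrite big_cons -tens_permM tmul_permr fs IHts.
Qed.

(** For [i] distinct from [j] and [k], the transposition [(i k)] is the conjugate of [(i j)] by
    [(j k)]. *)
Lemma swap_invariant_trans n (f : tens V n -> W) (i j k : 'I_n) :
  swap_invariant f i j -> swap_invariant f j k -> swap_invariant f i k.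
Proof.
move=> fij fjk x; have [->|ne_ij] := eqVneq i j; first exact: fjk.
have [->|ne_ik] := eqVneq i k; first by rewrite tperm1 tens_perm1.
have -> : tperm i k = (tperm j k * tperm i j * tperm j k)%g.
  by rewrite -{1}(tpermV j k) -mulgA -/(conjg _ _) tpermJ tpermL tpermD // eq_sym.
by rewrite -!tens_permM fjk fij fjk.
Qed.

Lemma swap_invariant_sym n (f : tens V n -> W) (i j : 'I_n) :
  swap_invariant f i j -> swap_invariant f j i.
Proof. by rewrite /swap_invariant tpermC. Qed.

(** Two indices below [n] both lie in the left block, so their transposition acts on the left factor
    of a product. The equation [e] lets one space [tens V p] be cut at different places. *)
Lemma swap_invariant_tmull n m p (e : (n + m = p)%N)
    (f : tens V p -> W) (i j : 'I_p) :
  linear f -> (forall s x y, f (tcast e (tmul (tens_perm s x) y)) = f (tcast e (tmul x y))) ->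
  (i < n)%N -> (j < n)%N -> swap_invariant f i j.
Proof.
case: p / e f i j => f i j fL fs ltin ltjn.
apply: linear_tmul_ext => [a ? ?|a ? ?|x y]; rewrite ?linearP ?fL //.
rewrite -[i](splitK i) -[j](splitK j).
case: splitP => [i' _|i' ei]; last by rewrite ei ltnNge leq_addr in ltin.
case: splitP => [j' _|j' ej]; last by rewrite ej ltnNge leq_addr in ltjn.
by rewrite /= -tmul_perml; move: (fs (tperm i' j') x y); rewrite !tcast_id.
Qed.

Lemma swap_invariant_tmulr n m p (e : (n + m = p)%N)
    (f : tens V p -> W) (i j : 'I_p) :
  linear f -> (forall s x y, f (tcast e (tmul x (tens_perm s y))) = f (tcast e (tmul x y))) ->
  (n <= i)%N -> (n <= j)%N -> swap_invariant f i j.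
Proof.
case: p / e f i j => f i j fL fs leni lenj.
apply: linear_tmul_ext => [a ? ?|a ? ?|x y]; rewrite ?linearP ?fL //.
rewrite -[i](splitK i) -[j](splitK j).
case: splitP => [i' ei|i' _]; first by rewrite leqNgt ei ltn_ord in leni.
case: splitP => [j' ej|j' _]; first by rewrite leqNgt ej ltn_ord in lenj.
by rewrite /= -tmul_permr; move: (fs (tperm i' j') x y); rewrite !tcast_id.
Qed.

(** Exchanging two adjacent blocks is itself a permutation of the [p] factors. *)
Lemma perm_invariant_tmulC n m p (e : (n + m = p)%N) (e' : (m + n = p)%N)
    (f : tens V p -> W) (x : tens V n) (y : tens V m) :
  linear f -> perm_invariant f ->
  f (tcast e (tmul x y)) = f (tcast e' (tmul y x)).
Proof.
move=> fL fs; move: x; apply: linear_pure_ext => [a ? ?|a ? ?|u].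
- by rewrite !(linearPl, linearPr, linearP, fL).
- by rewrite !(linearPl, linearPr, linearP, fL).
move: y; apply: linear_pure_ext => [a ? ?|a ? ?|v].
- by rewrite !(linearPl, linearPr, linearP, fL).
- by rewrite !(linearPl, linearPr, linearP, fL).
pose sw (z : 'I_m + 'I_n) : 'I_n + 'I_m :=
  match z with inl k => inr k | inr k => inl k end.
(* [h] sends each place in the concatenation of [v] and [u] to the place of the same vector in that
   of [u] and [v]. *)
pose h i := cast_ord e (unsplit (sw (split (cast_ord (esym e') i)))).
have h_inj : injective h.
  have sw_inj : injective sw by case=> a [] b // [->].
  apply: inj_comp (@cast_ord_inj _ _ _) _.
  apply: inj_comp (can_inj (@unsplitK _ _)) _.
  apply: inj_comp sw_inj _.
  exact: inj_comp (can_inj (@splitK _ _)) (@cast_ord_inj _ _ _).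
rewrite -(fs (perm h_inj)) !tmul_pure !tcast_pure tens_perm_pure.
congr (f (pure _)); apply/ffunP => i; rewrite !ffunE permE /h cast_ordK unsplitK.
by case: (split _).
Qed.

End SymmetricMaps.

(** * The iterated product: composition, symmetry and invariance of its values *)

Section Chain.
Variables (K : fieldType) (V : lmodType K) (n : nat).
Variable mu : {linear tens V n.+1 -> tens V n}.

Lemma mu_chain_is_linear k : linear (mu_chain mu k).
Proof.
elim: k => [|k IHk] a x y /=; first by rewrite linearP.
by rewrite !linearP IHk.
Qed.
HB.instance Definition _ k :=
  GRing.isLinear.Build K (tens V (n + k)) (tens V n) _ (mu_chain mu k)
    (@mu_chain_is_linear k).

Lemma mu_chainS k (e : (n.+1 + k = n + k.+1)%N)
    (x : tens V n.+1) (y : tens V k) :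
  mu_chain mu k.+1 (tcast e (tmul x y)) = mu_chain mu k (tmul (mu x) y).
Proof. by rewrite /= tcast_comp tcast_id tensid_tmul. Qed.

(** The two innermost maps of the chain form [mu_plus2 mu] on the first [n + 2] factors, which is
    where condition (ii) on [mu] enters. *)
Lemma mu_chainSS k (e : (n.+1 + 1 + k = n + k.+2)%N)
    (x : tens V (n.+1 + 1)) (y : tens V k) :
  mu_chain mu k.+2 (tcast e (tmul x y)) =
  mu_chain mu k (tmul (mu_plus2 mu x) y).
Proof.
rewrite /mu_plus2; move: x; apply: linear_tmul_ext => [a ? ?|a ? ?|x z].
- by rewrite !(linearPl, linearP).
- by rewrite !(linearPl, linearP).
have e1 : (n.+1 + (1 + k) = n + k.+2)%N by rewrite addSnnS.
have e2 : (n + 1 + k = n.+1 + k)%N by rewrite addn1.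
have e3 : (n.+1 + k = n + k.+1)%N by rewrite addSnnS.
rewrite tensid_tmul -(tmulA (addnA _ _ _)) tcast_comp (tcast_irr _ e1).
rewrite (mu_chainS e1 x (tmul z y)) -(mu_chainS e3) (tmul_castl _ e2).
by rewrite -(tmulA (addnA _ _ _)) !tcast_comp tcast_id.
Qed.

(** Induction on [l], peeling off the innermost [mu] on both sides. With [l = k = n] it turns a
    double product into a single chain on [3n] factors. *)
Lemma mu_chainD l k (e : (n + l + k = n + (l + k))%N)
    (x : tens V (n + l)) (y : tens V k) :
  mu_chain mu (l + k) (tcast e (tmul x y)) =
  mu_chain mu k (tmul (mu_chain mu l x) y).
Proof.
elim: l e x => [|l IHl] e x.
  have e0 : (n + 0 + k = n + k)%N by rewrite addn0.
  by rewrite [mu_chain mu 0 x]/= (tmul_castl _ e0) (tcast_irr _ e0).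
have e1 : (n.+1 + l = n + l.+1)%N by rewrite addSnnS.
(* Recutting [x] after its first [n + 1] factors exposes the argument of the innermost [mu]. *)
have -> : x = tcast e1 (tcast (esym e1) x) by rewrite tcast_comp tcast_id.
move: (tcast _ x) => {}x.
move: x; apply: linear_tmul_ext => [a ? ?|a ? ?|x z].
- by rewrite !(linearPl, linearP).
- by rewrite !(linearPl, linearP).
rewrite mu_chainS.
have e2 : (n + l.+1 + k = n.+1 + (l + k))%N by rewrite -addSnnS addnA.
have e3 : (n.+1 + l + k = n + l.+1 + k)%N by rewrite addSnnS.
have e4 : (n + l + k = n + (l + k))%N by rewrite addnA.
have e5 : (n.+1 + (l + k) = n + (l + k).+1)%N by rewrite addSnnS.
rewrite -(IHl e4) (tmul_castl e1 e3) -(tmulA (addnA _ _ _)) !tcast_comp.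
rewrite (tcast_irr _ e5) mu_chainS -(tmulA (addnA _ _ _)) !tcast_comp.
by rewrite tcast_id.
Qed.

(** The chain must have length at least one: [mu_chain mu 0] is only a cast, hence not symmetric in
    general. *)
Lemma mu_chain_perm_invariant k :
  perm_invariant mu -> perm_invariant (mu_plus2 mu) ->
  perm_invariant (mu_chain mu k.+1).
Proof.
move=> mu1 mu2; elim: k => [|k IHk]; apply: perm_invariant_tperm => i j.
  have e : (n.+1 + 0 = n + 1)%N by rewrite addSnnS.
  have lt1 (l : 'I_(n + 1)) : (l < n.+1)%N by rewrite -(addn1 n).
  apply: (swap_invariant_tmull (e := e)) => // [|s x y]; first exact: mu_chain_is_linear.
  by rewrite !mu_chainS mu1.
have e1 : (n.+1 + k.+1 = n + k.+2)%N by rewrite addSnnS.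
have e2 : (n.+1 + 1 + k = n + k.+2)%N by rewrite addn1 !addnS.
(* Counting from 0, [n.+1] is the one index common to the first [n + 2] and the last [k + 1] places.
   Every index can be swapped with this pivot, hence any two with each other. *)
have ltp : (n.+1 < n + k.+2)%N by rewrite !addnS !ltnS leq_addr.
have swp (l : 'I_(n + k.+2)) : swap_invariant (mu_chain mu k.+2) l (Ordinal ltp).
  have [ltl|gtl] := ltnP l n.+2.
    apply: (swap_invariant_tmull (e := e2)); rewrite ?addn1 //.
      exact: mu_chain_is_linear.
    by move=> s x y; rewrite !mu_chainSS mu2.
  apply: (swap_invariant_tmulr (e := e1)) => //; last exact: ltnW.
    exact: mu_chain_is_linear.
  by move=> s x y; rewrite !mu_chainS (perm_invariant_tmulr _ IHk).
exact: swap_invariant_trans (swp i) (swap_invariant_sym (swp j)).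
Qed.

(** The outermost map of a nonempty chain is [mu], so the induction only has to unfold down to a
    chain of length one. *)
Lemma mu_chain_invariant k x :
  (forall y, mu y \in @invariant K V n) ->
  mu_chain mu k.+1 x \in @invariant K V n.
Proof.
move=> mu_inv; elim: k x => [|k IHk] x; last exact: IHk.
have e : (n.+1 + 0 = n + 1)%N by rewrite addSnnS.
have -> : x = tcast e (tcast (esym e) x) by rewrite tcast_comp tcast_id.
apply/invariantP => s; move: (tcast _ x).
apply: linear_tmul_ext => [a ? ?|a ? ?|y z]; rewrite ?linearP //.
rewrite mu_chainS; move: z.
apply: linear_pure_ext => [a ? ?|a ? ?|v]; rewrite ?(linearPr, linearP) //.
by rewrite /= tmul_pure0 (invariantP _ (mu_inv y)).
Qed.

End Chain.

(** * Descent of a symmetric map to a product on the symmetric power *)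

Section InducedProduct.
Variables (K : fieldType) (V : lmodType K) (n : nat).
Variable M : tens V (n + n) -> tens V n.
Hypotheses (M_linear : linear M) (M_sym : perm_invariant M).
Hypothesis M_inv : forall x, M x \in @invariant K V n.

Lemma coinv_reprK (a : coinv V n) : coinv_proj (qrepr a) = a.
Proof. exact: qreprK. Qed.

(** An invariant linear map kills the relators of the coinvariants, so it does not see which
    representative is chosen. *)
Lemma coinv_projK (W : lmodType K) (f : tens V n -> W) x :
  linear f -> perm_invariant f -> f (qrepr (coinv_proj x)) = f x.
Proof.
move=> fL fs; pose F : {linear _ -> _} := HB.pack f (GRing.isLinear.Build _ _ _ _ f fL).
have Frel r : coinv_relator r -> F r = 0.
  by move=> [s [y ->]]; rewrite linearB /= fs subrr.
exact: (qliftE (f := F) Frel x).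
Qed.

Definition coinv_mul (a b : coinv V n) : inv V n :=
  Inv (M_inv (tmul (qrepr a) (qrepr b))).

Lemma coinv_mulE x y :
  inv_val (coinv_mul (coinv_proj x) (coinv_proj y)) = M (tmul x y).
Proof.
rewrite /= (coinv_projK (f := fun x => M (tmul x _))); last first.
- exact: perm_invariant_tmull.
- by move=> a u v; rewrite linearPl M_linear.
rewrite (coinv_projK (f := fun y => M (tmul _ y))) //.
- by move=> a u v; rewrite linearPr M_linear.
- exact: perm_invariant_tmulr.
Qed.

Lemma coinv_mul_is_bilinear : bilinear_for *:%R *:%R coinv_mul.
Proof.
split=> [b a u v|b a u v]; apply: val_inj; rewrite [RHS]/=.
  rewrite -[b]qreprK -[u]qreprK -[v]qreprK -(linearP (@coinv_proj K V n)).
  by rewrite [LHS]coinv_mulE linearPl M_linear -!coinv_mulE /= !qreprK.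
rewrite -[b]qreprK -[u]qreprK -[v]qreprK -(linearP (@coinv_proj K V n)).
by rewrite [LHS]coinv_mulE linearPr M_linear -!coinv_mulE /= !qreprK.
Qed.
HB.instance Definition _ :=
  bilinear_isBilinear.Build K (coinv V n) (coinv V n) (inv V n) _ _
    coinv_mul coinv_mul_is_bilinear.

Definition sym_mul (a b : SymPow V n) : SymPow V n := inv_coinv (coinv_mul a b).

Lemma sym_mul_is_bilinear : bilinear_for *:%R *:%R sym_mul.
Proof.
by split=> [b a u v|b a u v]; rewrite /sym_mul ?linearPl ?linearPr linearP.
Qed.
HB.instance Definition _ :=
  bilinear_isBilinear.Build K (SymPow V n) (SymPow V n) (SymPow V n) _ _
    sym_mul sym_mul_is_bilinear.

(** The last clause records the product on classes of tensors, the formula from which associativity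
    is computed. *)
Lemma induced_product_exists :
  exists op : {bilinear SymPow V n -> SymPow V n -> SymPow V n},
    [/\ induced_product M op, commutative op &
     forall x y, op (coinv_proj x) (coinv_proj y) = coinv_proj (M (tmul x y))].
Proof.
have mulE x y : sym_mul (coinv_proj x) (coinv_proj y) = coinv_proj (M (tmul x y)).
  by rewrite /sym_mul /inv_coinv coinv_mulE.
have mulC : commutative sym_mul.
  move=> a b; rewrite -[a]coinv_reprK -[b]coinv_reprK !mulE; congr coinv_proj.
  have e : (n + n = n + n)%N by [].
  by move: (perm_invariant_tmulC e e (qrepr a) (qrepr b) M_linear M_sym);
    rewrite !tcast_id.
exists sym_mul; split=> //.
by exists coinv_mul; split=> // x y; apply: coinv_mulE.
Qed.

End InducedProduct.

Theorem proposition4p1p1 (K : fieldType) (charK : [pchar K] =i pred0)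
    (V : lmodType K) (n : nat) (n_ge1 : (1 <= n)%N)
    (mu : {linear tens V n.+1 -> tens V n})
    (hmu : gen_comm_assoc_product mu) :
  exists op : {bilinear SymPow V n -> SymPow V n -> SymPow V n},
    [/\ induced_product (mu_chain mu n) op, commutative op & associative op].
Proof.
case: hmu => [[g1 g1E] [g2 g2E]].
have mu1 : perm_invariant mu by move=> s x; rewrite !g1E coinv_projP.
have mu2 : perm_invariant (mu_plus2 mu) by move=> s x; rewrite !g2E coinv_projP.
have mu_inv y : mu y \in @invariant K V n by rewrite g1E; apply: valP.
have chain_sym k : (0 < k)%N -> perm_invariant (mu_chain mu k).
  by case: k => // k _; apply: mu_chain_perm_invariant.
have chain_inv x : mu_chain mu n x \in @invariant K V n.
  (* The length is generalised to [k] so that the case analysis leaves the [n] in the type of [mu]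
     alone. *)
  suff inv k y : (0 < k)%N -> mu_chain mu k y \in @invariant K V n by exact: inv.
  by case: k y => // k y _; apply: mu_chain_invariant.
have chainL := @mu_chain_is_linear K V n mu.
have chain_sym_n := chain_sym n n_ge1.
have [op [opM opC opE]] :=
  induced_product_exists (chainL n) chain_sym_n chain_inv.
(* Commutativity turns [a (b c)] into [(b c) a], so that both sides are products bracketed to the
   left. *)
exists op; split=> // a b c; rewrite opC.
rewrite -[a]coinv_reprK -[b]coinv_reprK -[c]coinv_reprK !opE; congr coinv_proj.
have e : (n + n + n = n + (n + n))%N by rewrite addnA.
(* Both sides are now the same chain of length [n + n], and they differ by exchanging the block of
   [b] and [c] with that of [a]. *)
rewrite -!(mu_chainD mu e) -[in RHS](tmulA (addnA _ _ _)) tcast_comp.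
apply: perm_invariant_tmulC => //.
by apply: chain_sym; rewrite addn_gt0 n_ge1.
Qed.
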